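(* Let $q\ge5$ be an odd prime power. In $\mathrm{AG}(2,q)$ there exists a minimal blocking set of size $k$ for every integer $k$ with $2q-1\le k\le 3q-4$.
   Context: $\mathrm{AG}(2,q)$ is the affine plane of order $q$. A blocking set of $\mathrm{AG}(2,q)$ is a set of points meeting every line of $\mathrm{AG}(2,q)$ (it may contain lines); it is minimal if no proper subset is a blocking set. *)

(* Defs.v *)
From mathcomp Require Import all_boot all_algebra.

Set Implicit Arguments.
Unset Strict Implicit.
Unset Printing Implicit Defensive.

Import GRing.Theory.
Local Open Scope ring_scope.

(* AG(2,q) is taken to be the Desarguesian plane: its points are the pairs in
   F * F, where F is the field of order q. *)
Definition affine_line (F : finFieldType) (a b c : F) : {set F * F} :=
  [set P : F * F | a * P.1 + b * P.2 == c].

Definition AG_lines (F : finFieldType) : {set {set F * F}} :=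
  [set L : {set F * F} | [exists a : F, exists b : F, exists c : F,
     ((a != 0) || (b != 0)) && (L == affine_line a b c)]].

Definition blocking_set (F : finFieldType) (B : {set F * F}) : bool :=
  [forall L in AG_lines F, B :&: L != set0].

Definition minimal_blocking_set (F : finFieldType) (B : {set F * F}) : bool :=
  minset (@blocking_set F) B.

(* Main.v *)
(** Given a set [C] of scalars other than [0] and [1], delete from the line
    [Y = 0] the origin, delete from the parallel line [Y = 1] the points
    [(0, 1)] and [((1 - c) / c, 1)] for [c] in [C], and add one point on each
    other parallel [Y = c], namely [(1 - c, c)] if [c] is in [C] and [(0, c)]
    otherwise.  A line that meets the lines [Y = 0] and [Y = 1] in deleted points
    only joins the origin to [(0, 1)] or to some [((1 - c) / c, 1)]; it then
    contains an added point, as soon as [C] is not all of [F \ {0, 1}].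
    Conversely, let [C] be empty or contain [1/2].  Then every point of the set
    is the only one on some line: the horizontal line for an added point, the
    line through the origin for a point of [Y = 1], the line through [(0, 1)]
    for a point [(a, 0)] with [a <> 1], and for [(1, 0)] the line through
    [(0, 1)] if [C] is empty, and otherwise the line [X = 1], whose point
    [(1, 1)] is deleted because [1/2] is in [C].  The size is [3q - 4 - #|C|],
    with [#|C|] ranging from [0] to [q - 3]. *)
Require Import Defs.
From mathcomp Require Import all_boot all_algebra.
From mathcomp Require Import fingroup cyclic.
From mathcomp Require Import ring zify.

Set Implicit Arguments.
Unset Strict Implicit.
Unset Printing Implicit Defensive.

Section BlockingSets.
Import GRing.Theory.
Local Open Scope ring_scope.

(** By Lagrange in the additive group, [#|F|] copies of [1] sum to [0]; if [2] vanished, oddness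
    would reduce this sum to [1]. *)
Lemma odd_card_two_neq0 (F : finFieldType) : odd #|F| -> 2%:R != 0 :> F.
Proof.
move=> oddF; apply/eqP=> two0.
have: (1 : F) *+ #|F| = 0.
  by rewrite -FinRing.zmodXgE -cardsT expg_cardG ?inE.
rewrite -(odd_double_half #|F|) oddF -muln2 mulnC natrD natrM two0 mul0r addr0.
by move/eqP; rewrite oner_eq0.
Qed.

Lemma exists_subset_card (T : finType) (A : {set T}) n :
  (n <= #|A|)%N -> exists2 B : {set T}, B \subset A & #|B| = n.
Proof.
case/card_geqP=> s [uniq_s size_s sA]; exists [set x in s].
  by apply/subsetP=> x; rewrite inE => /sA.
by rewrite cardsE (card_uniqP uniq_s).
Qed.

Lemma exists_subset_card_mem (T : finType) (A : {set T}) (x : T) n :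
  x \in A -> (n < #|A|)%N ->
  exists B : {set T}, [/\ B \subset A, x \in B & #|B| = n.+1].
Proof.
move=> xA; rewrite (cardsD1 x) xA => /exists_subset_card[B /subsetD1P[BA xB] cardB].
exists (x |: B); rewrite subUset sub1set xA BA setU11 cardsU1 xB cardB.
by split.
Qed.

Lemma card_fibers (S T : finType) (B : {set S * T}) :
  #|B| = (\sum_(y : T) #|[set x : S | (x, y) \in B]|)%N.
Proof.
under eq_bigr do rewrite -sum1dep_card.
rewrite -sum1_card (exchange_big_dep predT) //= pair_big_dep.
by apply: eq_bigl => -[].
Qed.

Section AffinePlane.
Variable F : finFieldType.
Implicit Types (B : {set F * F}) (P : F * F).

Lemma affine_line_AG (a b c : F) :
  (a != 0) || (b != 0) -> affine_line a b c \in AG_lines F.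
Proof.
move=> ab; rewrite inE; apply/existsP; exists a; apply/existsP; exists b.
by apply/existsP; exists c; rewrite ab eqxx.
Qed.

Lemma blocking_setP B :
  reflect (forall a b c : F, (a != 0) || (b != 0) ->
             exists2 P, P \in B & a * P.1 + b * P.2 = c)
          (blocking_set B).
Proof.
apply: (iffP forall_inP) => [blockB a b c ab | blockB L].
  have /set0Pn[P] := blockB _ (affine_line_AG c ab).
  by rewrite !inE => /andP[PB /eqP]; exists P.
rewrite inE => /existsP[a /existsP[b /existsP[c /andP[ab /eqP->]]]].
have [P PB Pl] := blockB a b c ab; apply/set0Pn; exists P.
by rewrite !inE PB Pl eqxx.
Qed.

(** A blocking subset of [B] must meet the tangent at [P], and it can do so only in [P]. *)
Lemma minimal_blocking_set_tangents B :
  blocking_set B ->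
  (forall P, P \in B -> exists a b c : F, (a != 0) || (b != 0) /\
     forall Q, Q \in B -> a * Q.1 + b * Q.2 = c -> Q = P) ->
  minimal_blocking_set B.
Proof.
move=> blockB tangent; apply/minsetP; split=> // B' /blocking_setP blockB' sB'B.
apply/eqP; rewrite eqEsubset sB'B; apply/subsetP=> P /tangent[a [b [c [ab tP]]]].
have [Q QB' Ql] := blockB' a b c ab.
by rewrite -(tP Q) // (subsetP sB'B).
Qed.

Definition bent_set (C : {set F}) : {set F * F} :=
  [set P | if P.2 == 0 then P.1 != 0
           else if P.2 == 1 then P.1 \notin 0 |: [set (1 - c) / c | c in C]
           else P.1 == if P.2 \in C then 1 - P.2 else 0].

Section BentSet.
Variable C : {set F}.
Hypothesis C01 : C \subset ~: [set 0; 1].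

Let C_neq0 c : c \in C -> c != 0.
Proof. by move/(subsetP C01); rewrite !inE negb_or => /andP[]. Qed.

Let C_neq1 c : c \in C -> c != 1.
Proof. by move/(subsetP C01); rewrite !inE negb_or => /andP[]. Qed.

Lemma card_bent_set : (#|bent_set C| + #|C| + 4 = 3 * #|F|)%N.
Proof.
have cardC (X : {set F}) : (#|F| - #|X| = #|~: X|)%N by rewrite [RHS]cardsCs setCK.
have card_01 : #|([set 0; 1] : {set F})| = 2%N by rewrite cards2 eq_sym oner_neq0.
have card_F : (2 <= #|F|)%N by rewrite -card_01 max_card.
(* Count along the horizontal lines: [Y = 0], then [Y = 1], then one point on each of the others. *)
have -> : #|bent_set C| = (#|F| - 1 + (#|F| - #|C|.+1) + (#|F| - 2))%N.
  rewrite card_fibers (bigD1 0) //= (bigD1 1) ?oner_neq0 //= addnA.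
  congr (_ + _ + _)%N.
  - rewrite -(cards1 (0 : F)) cardC; apply: eq_card => x.
    by rewrite !inE /= eqxx.
  - have -> : [set x | (x, 1) \in bent_set C]
        = ~: (0 |: [set (1 - c) / c | c in C]).
      by apply/setP=> x; rewrite !inE /= oner_eq0 eqxx.
    rewrite cardsCs setCK cardsU1 card_in_imset; last first.
      move=> c d /C_neq0 c0 /C_neq0 d0 /eqP.
      by rewrite eqr_div // !mulrBl !mul1r mulrC [d * c]mulrC => /eqP/addIr.
    suff -> : 0 \notin [set (1 - c) / c | c in C] by [].
    apply/imsetP=> -[c cC /esym/eqP].
    rewrite mulf_eq0 invr_eq0 (negPf (C_neq0 cC)) orbF subr_eq0 eq_sym.
    by rewrite (negPf (C_neq1 cC)).
  - rewrite (eq_bigr (fun=> 1%N)) => [|y /andP[y0 y1]].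
      rewrite sum1dep_card -card_01 cardC; apply: eq_card => y.
      by rewrite !inE negb_or.
    rewrite -(cards1 (if y \in C then 1 - y else 0)); apply: eq_card => x.
    by rewrite !inE /= (negPf y0) (negPf y1).
have := subset_leq_card C01; rewrite -cardC card_01; lia.
Qed.

Lemma blocking_bent_set : C != ~: [set 0; 1] -> blocking_set (bent_set C).
Proof.
move=> C_proper; have [e] : exists e, e \in ~: [set 0; 1] :\: C.
  by apply/set0Pn; rewrite setD_eq0; apply: contra C_proper => ?; rewrite eqEsubset C01.
rewrite !inE negb_or => /and3P[eC e0 e1].
apply/blocking_setP => a b k.
have [-> /= b0 | a0 _] := eqVneq a 0.
  have [k0 | k0] := eqVneq (k / b) 0.
    exists (1, 0); first by rewrite inE /= eqxx oner_neq0.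
    by rewrite -[k](divfK b0) k0 /=; ring.
  have [k1 | k1] := eqVneq (k / b) 1.
    (* The abscissa [-1] is never deleted: [(1 - c) / c = c^-1 - 1], and [c^-1] is nonzero. *)
    exists (-1, 1); last by rewrite -[k](divfK b0) k1 /=; ring.
    rewrite inE /= oner_eq0 eqxx !inE oppr_eq0 oner_eq0 /=.
    apply/imsetP=> -[c /C_neq0 c0 /eqP]; rewrite -subr_eq0.
    have -> : -1 - (1 - c) / c = - c^-1 by field.
    by rewrite oppr_eq0 invr_eq0 (negPf c0).
  exists (if k / b \in C then 1 - k / b else 0, k / b).
    by rewrite inE /= (negPf k0) (negPf k1).
  by rewrite /= mul0r add0r mulrC divfK.
have [k0 | k0] := eqVneq k 0; last first.
  exists (k / a, 0); last by rewrite /= mulr0 addr0 mulrC divfK.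
  by rewrite inE /= eqxx mulf_neq0 ?invr_eq0.
(* The line now passes through the origin and meets [Y = 1] in [(- b / a, 1)]. *)
have [] := boolP (- b / a \in 0 |: [set (1 - c) / c | c in C]); last first.
  move=> b_notin; exists (- b / a, 1); first by rewrite inE /= oner_eq0 eqxx.
  by rewrite k0 /=; field.
rewrite !inE => /orP[ | /imsetP[c cC ba]].
  rewrite mulf_eq0 invr_eq0 (negPf a0) orbF oppr_eq0 => /eqP->.
  exists (0, e); last by rewrite k0 /=; ring.
  by rewrite inE /= (negPf e0) (negPf e1) (negPf eC).
(* This point is [c] times the deleted point [((1 - c) / c, 1)], hence on the same line through the
   origin. *)
have c0 := C_neq0 cC; exists (1 - c, c).
  by rewrite inE /= (negPf c0) (negPf (C_neq1 cC)) cC.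
have -> : b = - (a * ((1 - c) / c)) by rewrite -ba; field.
by rewrite k0 /=; field.
Qed.

Lemma minimal_bent_set :
  C != ~: [set 0; 1] -> 2%:R != 0 :> F -> C = set0 \/ 2%:R^-1 \in C ->
  minimal_blocking_set (bent_set C).
Proof.
move=> C_proper two0 C_half.
apply: (minimal_blocking_set_tangents (blocking_bent_set C_proper)) => -[x y].
rewrite inE /=; have [-> x0 | y0] := eqVneq y 0.
  (* The point [(1, 0)] is special: its join to [(0, 1)] is [X + Y = 1], which carries every added
     point [(1 - c, c)]. *)
  have [/andP[/eqP-> C0] | x1C] := boolP ((x == 1) && (C != set0)).
    case: C_half C0 => [-> | halfC _]; first by rewrite eqxx.
    exists 1, 0, 1; rewrite oner_neq0; split=> // -[u v].
    rewrite inE /= mul1r mul0r addr0 => + u1; rewrite u1.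
    have [-> // | v0] := eqVneq v 0.
    have [_ | _] := eqVneq v 1.
      rewrite !inE negb_or => /andP[_ /imsetP[]]; exists 2%:R^-1 => //.
      by rewrite invrK mulrBl mul1r mulVf // mulr2n addrK.
    case: ifP => _; last by rewrite oner_eq0.
    by rewrite -subr_eq0 subKr (negPf v0).
  exists 1, x, x; rewrite oner_neq0; split=> // -[u v].
  rewrite inE /= mul1r; have [-> _ | v0] := eqVneq v 0.
    by rewrite mulr0 addr0 => ->.
  have [-> | v1] := eqVneq v 1.
    rewrite !inE negb_or mulr1 => /andP[u0 _] /eqP.
    by rewrite -subr_eq0 addrK (negPf u0).
  have v1' : 1 - v != 0 by rewrite subr_eq0 eq_sym.
  (* An added point on this line gives [1 - v = x * (1 - v)], so [x = 1], or [0 = x * (1 - v)]; both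
     are excluded. *)
  case: ifP => [vC /eqP-> xv | _ /eqP-> xv].
    case/negP: x1C; apply/andP; split; last by apply/set0Pn; exists v.
    by apply/eqP/(mulIf v1'); rewrite mulrBr -{1}xv; ring.
  have /eqP : x * (1 - v) = 0 by rewrite mulrBr -{1}xv; ring.
  by rewrite mulf_eq0 (negPf x0) (negPf v1').
have [-> | y1 /eqP->] := eqVneq y 1; last first.
  exists 0, 1, y; rewrite oner_neq0 orbT; split=> // -[u v].
  rewrite inE /= mul0r add0r mul1r => + vy; rewrite vy.
  by rewrite (negPf y0) (negPf y1) => /eqP->.
rewrite !inE negb_or => /andP[x0 /imsetP xC].
exists 1, (- x), 0; rewrite oner_neq0; split=> // -[u v].
rewrite inE /= mul1r mulNr; have [-> u0 | v0] := eqVneq v 0.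
  by rewrite mulr0 subr0 => /eqP; rewrite (negPf u0).
have [-> _ | v1] := eqVneq v 1; first by rewrite mulr1 => /subr0_eq->.
(* An added point with [v] in [C] would force [x = (1 - v) / v], a deleted abscissa. *)
move=> + /subr0_eq xv; rewrite xv; case: ifP => [vC /eqP xvE | _].
  by case: xC; exists v; rewrite // -xvE mulfK.
by rewrite mulf_eq0 (negPf x0) (negPf v0).
Qed.

End BentSet.

Lemma exists_bent_parameter n :
  2%:R != 0 :> F -> (n + 3 <= #|F|)%N ->
  exists C : {set F}, [/\ C \subset ~: [set 0; 1], C != ~: [set 0; 1],
    C = set0 \/ 2%:R^-1 \in C & #|C| = n].
Proof.
move=> two0 n_le; set D := ~: [set 0; 1] : {set F}.
have card_D : #|D| = (#|F| - 2)%N.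
  by rewrite cardsCs setCK cards2 eq_sym oner_neq0.
suff [C [CD C_half card_C]] :
    exists C : {set F}, [/\ C \subset D, C = set0 \/ 2%:R^-1 \in C & #|C| = n].
  by exists C; split=> //; apply/eqP=> CE; move: card_D; rewrite -CE; lia.
case: n n_le => [|n] n_le.
  by exists set0; rewrite sub0set cards0; split=> //; left.
have halfD : 2%:R^-1 \in D.
  by rewrite !inE negb_or invr_eq0 two0 invr_eq1 -subr_eq0 addrK oner_neq0.
have [|C [CD halfC card_C]] := exists_subset_card_mem (n := n) halfD.
  by rewrite card_D; lia.
by exists C; split=> //; right.
Qed.

End AffinePlane.
End BlockingSets.

Theorem theorem4p6 (q : nat) (F : finFieldType) (hF : #|F| = q)
    (q_odd : odd q) (q_ge5 : 5 <= q) (k : nat)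
    (hk : 2 * q - 1 <= k <= 3 * q - 4) :
  exists B : {set F * F}, minimal_blocking_set B /\ #|B| = k.
Proof.
have two0 : (2%:R != 0 :> F)%R by apply: odd_card_two_neq0; rewrite hF.
have [|C [C01 C_proper C_half card_C]] :=
  (* The lower bound on [k] says exactly that this size is at most [q - 3]. *)
  exists_bent_parameter (n := 3 * q - 4 - k) two0; first by lia.
exists (bent_set C); split; first exact: minimal_bent_set.
by have := card_bent_set C01; rewrite card_C hF; lia.
Qed.
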